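(* Let $G_1,G_2$ be a pair of non-isomorphic but isospectral finite simple graphs on the same vertex set. Then there exist equivalent diffusion pairs $(G_1,\Delta_1)$ and $(G_2,\Delta_2)$ such that $$P_{G_1}^{\Delta_1}(X,Y)\neq P_{G_2}^{\Delta_2}(X,Y)$$ as bivariate polynomials.
   Context: Graphs are finite, simple and undirected. Two graphs are isospectral if their (unweighted) graph Laplacian matrices have the same spectrum with multiplicities. A diffusion pair $(G,\Delta)$ is a graph $G$ with edge set $E(G)$ together with diffusion parameters $\Delta\colon E(G)\to\{1,2,3,\dots\}$, $e\mapsto\alpha_e$. Let $L_G^\Delta(Y)$ be the weighted Laplacian matrix: for vertices $a\neq b$ its $(a,b)$ entry is $-Y^{\alpha_{ab}}$ if $ab$ is an edge and $0$ otherwise, and its $(a,a)$ entry is the sum of $Y^{\alpha_e}$ over all edges $e$ incident to $a$. The spectral polynomial is $P_G^\Delta(X,Y)=\det\bigl(X\cdot I-L_G^\Delta(Y)\bigr)\in\mathbb{Z}[X,Y]$. Two diffusion pairs $(G_1,\Delta_1)$, $(G_2,\Delta_2)$, with $G_1,G_2$ graphs on the same vertex set, are equivalent if there is a bijection $E(G_1)\to E(G_2)$ (not required to come from a map of vertices) taking each edge to an edge with the same diffusion parameter. *)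

(* Defs.v *)
From HB Require Import structures.
From mathcomp Require Import all_boot all_order all_algebra all_field.

Set Implicit Arguments.
Unset Strict Implicit.
Unset Printing Implicit Defensive.

Import GRing.Theory.
Local Open Scope ring_scope.

Record sgraph (V : finType) := SGraph {
  adj : rel V;
  adj_sym : symmetric adj;
  adj_irr : irreflexive adj
}.

Definition edge_set (V : finType) (G : sgraph V) : {set {set V}} :=
  [set [set p.1; p.2] | p : V * V & adj G p.1 p.2].

Definition edge (V : finType) (G : sgraph V) : finType :=
  {e : {set V} | e \in edge_set G}.

Definition isomorphic (V : finType) (G1 G2 : sgraph V) : Prop :=
  exists2 f : V -> V, bijective f & forall x y, adj G2 (f x) (f y) = adj G1 x y.

(* [insub [set a; b]] is [Some e] when {a, b} is the edge e of G, and [None]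
   when {a, b} is not an edge. *)
Definition laplacian (R : pzRingType) (V : finType) (G : sgraph V)
    (w : edge G -> R) : 'M[R]_#|V| :=
  \matrix_(i, j)
    let a := enum_val i in
    let b := enum_val j in
    if a == b then \sum_(e : edge G | a \in val e) w e
    else if insub [set a; b] is Some e then - w e else 0.

(* The eigenvalue multiplicities are the algebraic ones; the spectrum is taken
   in the algebraically closed field [algC]. *)
Definition isospectral (V : finType) (G1 G2 : sgraph V) : Prop :=
  forall a : algC,
    mup a (char_poly (laplacian (fun _ : edge G1 => 1 : algC))) =
    mup a (char_poly (laplacian (fun _ : edge G2 => 1 : algC))).

Record diffusion (V : finType) (G : sgraph V) := Diffusion {
  diff_param :> edge G -> nat;
  diff_param_gt0 : forall e, (0 < diff_param e)%N
}.

Definition equivalent (V : finType) (G1 G2 : sgraph V)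
    (D1 : diffusion G1) (D2 : diffusion G2) : Prop :=
  exists2 f : edge G1 -> edge G2, bijective f & forall e, D2 (f e) = D1 e.

(* Z[X, Y] is encoded as Z[Y][X]: the inner ['X] is Y and the outer one, the
   indeterminate of [char_poly], is X. *)
Definition spectral_poly (V : finType) (G : sgraph V) (D : diffusion G) :
    {poly {poly int}} :=
  char_poly (laplacian (fun e : edge G => 'X^(D e) : {poly int})).

(* Main.v *)
(** Let e and f run over the edges of a weighted graph with Laplacian L; then
    tr(L^2) = 2 sum_e w_e^2 + sum_(e, f) |e :&: f| w_e w_f.  Give two edges s, t
    weight Y^2 and all others weight Y: the coefficient of Y^4 in tr(L^2) is
    8 + 2 |s :&: t|.  As the characteristic polynomial determines tr(L^2),
    matching two incident edges of one graph with two disjoint edges of the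
    other separates the spectral polynomials.  If no such choice exists, then
    either both graphs are matchings, or in both of them any two edges meet, so
    that each is a star or a triangle.  Isospectral graphs have equally many
    edges, hence are isomorphic in these cases, except possibly for a star with
    three edges and a triangle: but 4 is an eigenvalue of the former only. *)

Require Import Defs.
From mathcomp Require Import all_boot all_order all_algebra all_field.
From mathcomp Require Import zify.

Set Implicit Arguments.
Unset Strict Implicit.
Unset Printing Implicit Defensive.

Import GRing.Theory Num.Theory.
Local Open Scope ring_scope.

(** * Characteristic polynomials, traces and multiplicities *)

Lemma mxtrace_char_poly (R : nzRingType) (n : nat) (A B : 'M[R]_n) :
  char_poly A = char_poly B -> \tr A = \tr B.
Proof.
case: n A B => [|n] A B eqAB; first by rewrite /mxtrace !big_ord0.
by apply: oppr_inj; rewrite -!char_poly_trace // eqAB.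
Qed.

(** Substitution is a ring morphism, so it passes through the determinant; below, [q] is ['X^2] or
    [- 'X]. *)
Lemma comp_char_poly (R : comNzRingType) (n : nat) (A : 'M[R]_n)
    (q : {poly R}) :
  char_poly A \Po q = \det (q%:M - map_mx polyC A).
Proof.
rewrite /char_poly -det_map_mx; congr (\det _).
apply/matrixP=> i j; rewrite !mxE rmorphB rmorphMn /=.
by rewrite comp_polyX comp_polyC.
Qed.

(* [X^2 - A^2 = (X - A) (X + A)]. *)
Lemma char_poly_mulmx_self (R : comNzRingType) (n : nat) (A : 'M[R]_n) :
  char_poly (A *m A) \Po 'X^2 =
  char_poly A * ((-1) ^+ n * (char_poly A \Po - 'X)).
Proof.
have mapAA : map_mx polyC (A *m A) = map_mx polyC A *m map_mx polyC A.
  exact: map_mxM.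
rewrite !comp_char_poly /char_poly /char_poly_mx -detZ -det_mulmx mapAA.
move: (map_mx polyC A) => B; congr (\det _).
rewrite scaleN1r opprB (raddfN (@scalar_mx _ n)) opprK.
rewrite mulmxBl !mulmxDr -(scalar_mxM _ 'X 'X) -scalar_mxC.
by rewrite opprD addrA addrAC [_ + ('X * 'X)%:M]addrC addrK.
Qed.

(** Substituting ['X^2] only moves the coefficient of index [i] to index [i * 2], so nothing is
    lost. No eigenvalues are involved, hence this applies over [{poly int}]. *)
Lemma eq_char_poly_mulmx_self (R : comNzRingType) (n : nat) (A B : 'M[R]_n) :
  char_poly A = char_poly B -> char_poly (A *m A) = char_poly (B *m B).
Proof.
move=> eqAB; apply/polyP=> i.
have := congr1 (fun p : {poly R} => p`_(i * 2)) (char_poly_mulmx_self A).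
rewrite eqAB -char_poly_mulmx_self !coef_comp_poly_Xn //.
by rewrite dvdn_mull // mulnK // => ->.
Qed.

Lemma eq_mup_monic (F : closedFieldType) (p q : {poly F}) :
  p \is monic -> q \is monic -> (forall a, mup a p = mup a q) -> p = q.
Proof.
have [r ->] := closed_field_poly_normal p.
have [s ->] := closed_field_poly_normal q.
rewrite !monicE !lead_coefZ !(monicP (monic_prod_XsubC _ _ _)) !mulr1.
move=> /eqP-> /eqP->; rewrite !scale1r => eq_mup.
(* [perm_eq] compares how often each [a] occurs in the two lists of roots, and this count is the
   multiplicity of [a]. *)
apply: perm_big; apply/allP=> a _ /=.
by rewrite -!mu_prod_XsubC eq_mup.
Qed.

Lemma isospectral_char_poly (V : finType) (G1 G2 : sgraph V) :
  isospectral G1 G2 ->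
  char_poly (laplacian (fun _ : edge G1 => 1 : algC)) =
  char_poly (laplacian (fun _ : edge G2 => 1 : algC)).
Proof. by apply: eq_mup_monic; apply: char_poly_monic. Qed.

(** * Edges as vertex sets, and traces of the Laplacian *)

Lemma edge_setE (V : finType) (G : sgraph V) (x y : V) :
  ([set x; y] \in edge_set G) = adj G x y.
Proof.
apply/imsetP/idP=> [[[a b]] | xy]; last by exists (x, y) => //; rewrite inE.
rewrite inE /= => ab eq_xy.
have neq_ab : a != b by apply: contraTneq ab => ->; rewrite adj_irr.
have : a \in [set x; y] by rewrite eq_xy set21.
have : b \in [set x; y] by rewrite eq_xy set22.
rewrite !inE => /orP[] /eqP eb /orP[] /eqP ea; move: neq_ab ab;
  by rewrite ea eb ?eqxx // adj_sym.
Qed.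

Lemma edgeP (V : finType) (G : sgraph V) (e : edge G) :
  exists x y, adj G x y /\ val e = [set x; y].
Proof.
have /imsetP[[x y]] := valP e; rewrite inE /= => xy ->.
by exists x, y.
Qed.

Lemma adj_neq (V : finType) (G : sgraph V) (x y : V) : adj G x y -> x != y.
Proof. by apply: contraTneq => ->; rewrite adj_irr. Qed.

Lemma card_edge (V : finType) (G : sgraph V) (e : edge G) : #|val e| = 2%N.
Proof. by have [x [y [/adj_neq xy ->]]] := edgeP e; rewrite cards2 xy. Qed.

Lemma insub_loop (V : finType) (G : sgraph V) (a : V) :
  insub [set a; a] = None :> option (edge G).
Proof. by apply: insubF; rewrite /= edge_setE adj_irr. Qed.

Section Laplacian.
Variables (V : finType) (G : sgraph V) (R : pzRingType).

(** Each edge at [b] has exactly one other endpoint. This turns sums over vertices, as in matrix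
    products, into sums over incident edges, as on the diagonal of the Laplacian. *)
Lemma sum_incident (F : edge G -> R) (b : V) :
  \sum_(a : V) oapp F 0 (insub [set a; b]) =
  \sum_(e : edge G | b \in val e) F e.
Proof.
have insub_sum a : oapp F 0 (insub [set a; b]) =
    \sum_(e : edge G | val e == [set a; b]) F e.
  case: insubP => [e _ eq_e | nedge] /=.
    by rewrite (big_pred1 e) // => f; rewrite -eq_e.
  by rewrite big_pred0 // => e; apply: contraNF nedge => /eqP<-; apply: valP.
under eq_bigr do rewrite insub_sum.
rewrite (exchange_big_dep (fun e : edge G => b \in val e)) /=; last first.
  by move=> a e _ /eqP->; rewrite set22.
apply: eq_bigr => e be; have [x [y [xy eq_e]]] := edgeP e.
have {xy} neq_xy := adj_neq xy.
wlog eq_b : x y eq_e neq_xy / b = y.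
  move=> IH; have: b \in [set x; y] by rewrite -eq_e.
  rewrite !inE => /orP[] /eqP eb; last exact: (IH x y).
  by apply: (IH y x); rewrite 1?eq_sym // setUC.
rewrite (big_pred1 x) // => a /=; rewrite eq_e eq_b.
apply/eqP/eqP=> [eq_ay | -> //].
have : x \in [set a; y] by rewrite -eq_ay set21.
by rewrite !inE (negPf neq_xy) orbF => /eqP.
Qed.

Variable w : edge G -> R.

(** Degree matrix minus weighted adjacency matrix; no case distinction is left, since a loop is
    never an edge. *)
Lemma laplacianE (a b : V) :
  laplacian w (enum_rank a) (enum_rank b) =
  (a == b)%:R * (\sum_(e : edge G | b \in val e) w e)
    - oapp w 0 (insub [set a; b]).
Proof.
rewrite mxE !enum_rankK /=; case: eqP => [-> | _].
  by rewrite mul1r insub_loop subr0.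
by rewrite mul0r sub0r; case: insubP => //=; rewrite oppr0.
Qed.

Lemma sum_ord_enum_rank (F : 'I_#|V| -> R) :
  \sum_i F i = \sum_(a : V) F (enum_rank a).
Proof.
by rewrite (reindex_onto enum_rank enum_val) => [|i _]; rewrite ?enum_valK //;
  apply: eq_bigl => a; rewrite enum_rankK eqxx.
Qed.

Lemma sum_sum_incident (F : edge G -> R) :
  \sum_(b : V) \sum_(e : edge G | b \in val e) F e = \sum_e F e *+ 2.
Proof.
rewrite (exchange_big_dep predT) //=; apply: eq_bigr => e _.
by rewrite sumr_const card_edge.
Qed.

Lemma mxtrace_laplacian : \tr (laplacian w) = \sum_e w e *+ 2.
Proof.
rewrite /mxtrace sum_ord_enum_rank -sum_sum_incident; apply: eq_bigr => a _.
by rewrite laplacianE eqxx mul1r insub_loop subr0.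
Qed.

End Laplacian.

(** At [b], the diagonal entry of the square is the squared weighted degree plus the sum of w_e^2
    over the edges at [b]. Summed over [b], each w_e^2 occurs once per endpoint of e, and each w_e
    w_f once per vertex common to e and f. *)
Lemma mxtrace_laplacian_sqr (R : comNzRingType) (V : finType) (G : sgraph V)
    (w : edge G -> R) :
  \tr (laplacian w *m laplacian w) =
  \sum_e w e ^+ 2 *+ 2 +
  \sum_e \sum_f w e * w f *+ #|val e :&: val f|.
Proof.
transitivity (\sum_b ((\sum_(e : edge G | b \in val e) w e ^+ 2)
   + (\sum_(e : edge G | b \in val e) w e) ^+ 2)); last first.
  rewrite big_split /= sum_sum_incident; congr (_ + _).
  under eq_bigr => b _ do
    rewrite expr2 big_distrlr /= pair_big_dep /=.
  rewrite [RHS]pair_big /= (exchange_big_dep predT) //=.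
  apply: eq_bigr => -[e f] _ /=; rewrite sumr_const; congr (_ *+ _).
  by apply: eq_card => a; rewrite !inE.
rewrite /mxtrace sum_ord_enum_rank; apply: eq_bigr => b _.
rewrite mxE sum_ord_enum_rank -(sum_incident (fun e => w e ^+ 2)).
rewrite (bigD1 b) //= [in RHS](bigD1 b) //= insub_loop /= add0r.
rewrite laplacianE eqxx insub_loop /= mul1r subr0 addrC.
congr (_ + _); apply: eq_bigr => a ab.
rewrite !laplacianE [b == a]eq_sym (negPf ab) !mul0r !sub0r mulrNN.
rewrite [[set b; a]]setUC.
by case: insubP => [e _ _|_] /=; rewrite ?expr2 // mulr0.
Qed.

(** Lets eigenvector equations be read vertex by vertex; [eigenvalue] is about row vectors. *)
Lemma mul_laplacian (R : pzRingType) (V : finType) (G : sgraph V)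
    (v : 'rV[R]_#|V|) (b : V) :
  (v *m laplacian (fun _ : edge G => 1)) 0 (enum_rank b) =
  \sum_(a | adj G a b) (v 0 (enum_rank b) - v 0 (enum_rank a)).
Proof.
have adjE a : oapp (fun=> 1) 0 (insub [set a; b] : option (edge G)) =
    (adj G a b)%:R :> R.
  by case: insubP => [e | /negPf]; rewrite edge_setE => ->.
rewrite mxE sum_ord_enum_rank.
under eq_bigr => a _ do rewrite laplacianE mulrBr adjE.
rewrite sumrB (bigD1 b) //= eqxx mul1r.
rewrite [X in _ + X - _]big1 => [|a /negPf->]; last first.
  by rewrite mul0r mulr0.
rewrite addr0 -sum_incident mulr_sumr -sumrB [RHS]big_mkcond /=.
by apply: eq_bigr => a _; rewrite adjE; case: ifP; rewrite ?mulr1 ?mulr0 ?subrr.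
Qed.

(** Exponents are 2 on [s], [t] and 1 elsewhere, so degree 4 is reached only by terms with all
    indices in {s, t}. The squares contribute 4, the pairs (s, s) and (t, t) another 4, and (s, t)
    and (t, s) the rest. *)
Lemma coef4_mxtrace_laplacian_sqr (V : finType) (G : sgraph V) (s t : edge G) :
  s != t ->
  (\tr (laplacian (fun e => 'X^((e \in [set s; t]).+1))
     *m laplacian (fun e => 'X^((e \in [set s; t]).+1))) : {poly int})`_4 =
  (8 + #|val s :&: val t| * 2)%N%:R.
Proof.
move=> st; set A := [set s; t]; rewrite mxtrace_laplacian_sqr coefD !coef_sum.
have st1 : s \notin [set t] by rewrite inE.
have [sA tA] : s \in A /\ t \in A by rewrite set21 set22.
under eq_bigr => e _ do rewrite coefMn -exprM coefXn.
under [X in _ + X]eq_bigr => e _.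
  rewrite coef_sum.
  under eq_bigr => f _ do rewrite -exprD coefMn coefXn.
  over.
rewrite (bigID (mem A)) /= [X in _ + X + _]big1 => [|e /negPf->]; last first.
  by rewrite mul0rn.
rewrite [X in _ + X](bigID (mem A)) /= [X in _ + (_ + X)]big1; last first.
  by move=> e /negPf->; rewrite big1 // => f _; case: (f \in A); rewrite mul0rn.
have inner e : e \in A ->
   \sum_f (4 == (e \in A).+1 + (f \in A).+1)%:R *+ #|val e :&: val f| =
   (#|val e :&: val s| + #|val e :&: val t|)%N%:R :> int.
  move=> eA; rewrite eA (bigID (mem A)) /=.
  rewrite [X in _ + X]big1 => [|f /negPf->]; last first.
    by rewrite mul0rn.
  by rewrite big_setU1 //= big_set1 sA tA addr0 natrD.
rewrite !addr0 (eq_bigr _ inner) !big_setU1 //= !big_set1 sA tA.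
rewrite !setIid !card_edge [val t :&: val s]setIC.
rewrite -!mulrnA -!natrD; congr (_%:R) => /=; lia.
Qed.

(** * Extending injections between finite types *)

Section Transfer.
Variables (T T' : finType) (y0 : T') (A : {set T}) (B : {set T'}).

(** For equinumerous sets this is a bijection of [A] onto [B]; off [A] its value is then the default
    [y0]. *)
Definition transfer (x : T) : T' := nth y0 (enum B) (index x (enum A)).

Hypothesis eqAB : #|A| = #|B|.

Lemma transfer_index x : x \in A -> (index x (enum A) < size (enum B))%N.
Proof. by move=> Ax; rewrite -cardE -eqAB cardE index_mem mem_enum. Qed.

Lemma transfer_mem x : x \in A -> transfer x \in B.
Proof. by move=> Ax; rewrite -mem_enum mem_nth // transfer_index. Qed.

Lemma transfer_inj : {in A &, injective transfer}.
Proof.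
move=> x y Ax Ay /eqP; rewrite nth_uniq ?enum_uniq ?transfer_index //.
by move=> /eqP; apply: (index_inj x) => //; rewrite mem_enum.
Qed.

End Transfer.

(** The complements of [S] and of its image are equinumerous, so [transfer] pairs them off. Used for
    edges as well as for vertices. *)
Lemma extend_inj (T T' : finType) (S : {set T}) (f : T -> T') :
  #|T| = #|T'| -> {in S &, injective f} ->
  exists2 g : T -> T', bijective g & {in S, g =1 f}.
Proof.
move=> eqTT' injf; case: (pickP (mem T)) => [x0 _ | T0]; last first.
  exists f => //; apply: inj_card_bij; last by rewrite eqTT'.
  by move=> x; have := T0 x; rewrite inE.
have eqC : #|~: S| = #|~: (f @: S)|.
  apply/eqP; rewrite -(eqn_add2l #|S|) cardsC.
  by rewrite -(card_in_imset injf) cardsC eqTT'.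
pose h := transfer (f x0) (~: S) (~: (f @: S)).
have disj x y : x \in S -> y \notin S -> f x <> h y.
  move=> Sx Sy fx; have := transfer_mem (f x0) eqC (x := y).
  by rewrite -/(h y) -fx !inE Sy imset_f // => /(_ isT).
exists (fun x => if x \in S then f x else h x) => [|x ->] //.
apply: inj_card_bij; last by rewrite eqTT'.
move=> x y; case: ifPn => Sx; case: ifPn => Sy.
- exact: injf.
- by move/(disj _ _ Sx Sy).
- by move/esym/(disj _ _ Sy Sx).
- by apply: (transfer_inj (y0 := f x0) eqC); rewrite inE.
Qed.

(** * Separation of the spectral polynomials *)

Lemma separating_diffusion (V : finType) (G1 G2 : sgraph V)
    (s1 t1 : edge G1) (s2 t2 : edge G2) :
  #|edge G1| = #|edge G2| -> s1 != t1 -> s2 != t2 ->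
  #|val s1 :&: val t1| != #|val s2 :&: val t2| ->
  exists (D1 : diffusion G1) (D2 : diffusion G2),
    equivalent D1 D2 /\ spectral_poly D1 <> spectral_poly D2.
Proof.
move=> eqE st1 st2 neq_st.
pose D (G : sgraph V) (s t : edge G) :=
  @Diffusion V G (fun e => (e \in [set s; t]).+1) (fun=> ltn0Sn _).
exists (D G1 s1 t1), (D G2 s2 t2); split; last first.
  move=> /eq_char_poly_mulmx_self/mxtrace_char_poly.
  move=> /(congr1 (fun p : {poly int} => p`_4)).
  rewrite !coef4_mxtrace_laplacian_sqr // => /eqP.
  by rewrite eqr_nat eqn_add2l eqn_pmul2r // (negPf neq_st).
(* Only the two chosen edges need a prescribed image: all others carry the parameter 1. *)
have [|g bijg gf] := @extend_inj _ _ [set s1; t1]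
    (fun e => if e == s1 then s2 else t2) eqE.
  move=> x y; rewrite !inE => /orP[]/eqP-> /orP[]/eqP->;
    by rewrite ?eqxx // eq_sym (negPf st1) => /eqP;
    rewrite 1?[t2 == _]eq_sym (negPf st2).
have [gs gt] : g s1 = s2 /\ g t1 = t2.
  by rewrite !gf ?set21 ?set22 // eqxx eq_sym (negPf st1).
exists g => // e /=; congr (nat_of_bool _).+1.
by rewrite !inE -gs -gt !(inj_eq (bij_inj bijg)).
Qed.

(** * Isomorphism criteria for matchings, stars and cliques *)

(** All non-isolated vertices lie in [S], so [f] may be extended off [S] to any permutation. That
    permutation maps edges injectively to edges, hence onto them by counting, and so it also
    reflects adjacency. *)
Lemma edge_hom_isomorphic (V : finType) (G1 G2 : sgraph V) (S : {set V})
    (f : V -> V) :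
  #|edge G1| = #|edge G2| -> {in S &, injective f} ->
  (forall x y, adj G1 x y -> x \in S) ->
  (forall x y, adj G1 x y -> adj G2 (f x) (f y)) ->
  isomorphic G1 G2.
Proof.
move=> eqE injf subS homf.
have [g bijg gf] := extend_inj (erefl #|V|) injf.
have homg x y : adj G1 x y -> adj G2 (g x) (g y).
  move=> xy; have yx : adj G1 y x by rewrite adj_sym.
  by rewrite !gf ?homf ?(subS _ _ xy) ?(subS _ _ yx).
have imE : [set g @: (e : {set V}) | e in edge_set G1] = edge_set G2.
  apply/eqP; rewrite eqEcard; apply/andP; split.
    apply/subsetP=> _ /imsetP[e eE ->].
    have [x [y [/homg xy eq_e]]] := edgeP (Sub e eE : edge G1).
    by rewrite (eq_e : e = _) imsetU !imset_set1 edge_setE.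
  rewrite [leqRHS]card_imset; last by apply: imset_inj; apply: bij_inj.
  by have := eqE; rewrite !card_sig => ->.
exists g => // x y; apply/idP/idP=> [|/homg //].
rewrite -!edge_setE -imE => /imsetP[e eE].
by rewrite -!imset_set1 -imsetU => /(imset_inj (bij_inj bijg))->.
Qed.

Lemma adj_edge (V : finType) (G : sgraph V) (x y : V) :
  adj G x y -> exists e : edge G, val e = [set x; y].
Proof. by rewrite -edge_setE => xyE; exists (Sub [set x; y] xyE). Qed.

Lemma edge_adj (V : finType) (G : sgraph V) (e : edge G) (x y : V) :
  x \in val e -> y \in val e -> x != y -> adj G x y.
Proof.
move=> xe ye xy; rewrite -edge_setE (_ : [set x; y] = val e) ?(valP e) //.
apply/eqP; rewrite eqEcard cards2 xy card_edge andbT.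
by apply/subsetP=> z; rewrite !inE => /orP[]/eqP->.
Qed.

Lemma matching_isomorphic (V : finType) (G1 G2 : sgraph V) :
  #|edge G1| = #|edge G2| ->
  (forall e f : edge G1, e != f -> [disjoint val e & val f]) ->
  (forall e f : edge G2, e != f -> [disjoint val e & val f]) ->
  isomorphic G1 G2.
Proof.
move=> eqE dis1 dis2.
have [v0 _ | V0] := pickP (mem V); last first.
  by exists id => [|x]; [exists id | have := V0 x].
pose phi (e : edge G1) : edge G2 := enum_val (cast_ord eqE (enum_rank e)).
have phi_inj : injective phi.
  by move=> e f /enum_val_inj/cast_ord_inj/enum_rank_inj.
have dis_eq (G : sgraph V) (x : V) (e f : edge G) :
    (forall e f : edge G, e != f -> [disjoint val e & val f]) ->
    x \in val e -> x \in val f -> e = f.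
  by move=> dis xe; apply: contraTeq => /dis/disjointFr->.
have eq_card_phi (e : edge G1) : #|val e| = #|val (phi e)|.
  by rewrite !card_edge.
(* A vertex lies on at most one edge, so the endpoints can be mapped edge by edge along [phi]. *)
pose F x := if [pick e : edge G1 | x \in val e] is Some e
            then transfer v0 (val e) (val (phi e)) x else x.
have FE (e : edge G1) x :
    x \in val e -> F x = transfer v0 (val e) (val (phi e)) x.
  move=> xe; rewrite /F; case: pickP => [f xf | /(_ e)]; last by rewrite xe.
  by rewrite (dis_eq _ _ _ _ dis1 xf xe).
have Fmem (e : edge G1) x : x \in val e -> F x \in val (phi e).
  by move=> xe; rewrite (FE e) // transfer_mem.
have Finj (e : edge G1) x y : x \in val e -> y \in val e -> F x = F y -> x = y.
  by move=> xe ye; rewrite !(FE e) //; apply: transfer_inj.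
apply: (edge_hom_isomorphic (S := [set x | [exists e : edge G1, x \in val e]])
          (f := F) eqE) => [x y | x y /adj_edge[e eq_e] | x y xy].
- rewrite !inE => /existsP[e xe] /existsP[f yf] eqF.
  (* The common image lies on both [phi e] and [phi f], which therefore coincide. *)
  apply: (Finj e) => //; rewrite (_ : e = f) //; apply: phi_inj.
  by apply: (dis_eq _ (F x)) => //; [exact: Fmem | rewrite eqF; exact: Fmem].
- by rewrite inE; apply/existsP; exists e; rewrite eq_e set21.
have [e eq_e] := adj_edge xy.
have [xe ye] : x \in val e /\ y \in val e by rewrite eq_e set21 set22.
apply: (@edge_adj _ _ (phi e)); rewrite ?Fmem //.
by apply: contraNneq (adj_neq xy) => /(Finj e _ _ xe ye)->.
Qed.

(** Boolean, with one quantifier over pairs, so that its failure exhibits an edge avoiding [c]. An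
    edgeless graph is a star at every vertex. *)
Definition star (V : finType) (G : sgraph V) (c : V) : bool :=
  [forall p : V * V, adj G p.1 p.2 ==> (p.1 == c) || (p.2 == c)].

Lemma starP (V : finType) (G : sgraph V) (c x y : V) :
  star G c -> adj G x y -> (x == c) || (y == c).
Proof. by move=> /forallP/(_ (x, y))/implyP. Qed.

Lemma card_edge_star (V : finType) (G : sgraph V) (c : V) :
  star G c -> #|edge G| = #|[set x | adj G c x]|.
Proof.
move=> stc; rewrite card_sig -[RHS](card_in_imset (f := fun x => [set c; x])).
  apply: eq_card => e; apply/idP/imsetP=> [eE | [x]]; last first.
    by rewrite inE => cx ->; rewrite inE edge_setE.
  have [x [y [xy eq_e]]] := edgeP (Sub e eE : edge G).
  rewrite /= in eq_e; rewrite eq_e.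
  have /orP[/eqP eqc | /eqP eqc] := starP stc xy.
    by exists y; rewrite ?inE -eqc.
  by exists x; rewrite 1?setUC -?eqc // inE adj_sym.
move=> x y; rewrite !inE => cx cy eq_xy.
have : x \in [set c; y] by rewrite -eq_xy set22.
by rewrite !inE eq_sym (negPf (adj_neq cx)) => /eqP.
Qed.

Lemma star_isomorphic (V : finType) (G1 G2 : sgraph V) (c1 c2 : V) :
  #|edge G1| = #|edge G2| -> star G1 c1 -> star G2 c2 -> isomorphic G1 G2.
Proof.
move=> eqE st1 st2; have := eqE.
rewrite (card_edge_star st1) (card_edge_star st2).
set N1 := [set x | _]; set N2 := [set x | _] => eqN.
pose F x := if x == c1 then c2 else transfer c2 N1 N2 x.
have FN x : x \in N1 -> F x = transfer c2 N1 N2 x /\ adj G2 c2 (F x).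
  move=> Nx; have := transfer_mem c2 eqN Nx; rewrite inE /F.
  by case: eqP Nx => // ->; rewrite inE adj_irr.
have Fc : F c1 = c2 by rewrite /F eqxx.
apply: (edge_hom_isomorphic (S := c1 |: N1) (f := F) eqE).
- move=> x y /setU1P[-> | Nx] /setU1P[-> | Ny] //.
  + by rewrite Fc; have [_ /adj_neq/eqP] := FN _ Ny.
  + by rewrite Fc => /esym; have [_ /adj_neq/eqP] := FN _ Nx.
  by have [-> _] := FN _ Nx; have [-> _] := FN _ Ny; apply: transfer_inj.
- move=> x y xy; rewrite !inE; have /orP[/eqP-> | /eqP yc] := starP st1 xy.
    by rewrite eqxx.
  by rewrite -yc adj_sym xy orbT.
move=> x y xy; have /orP[/eqP xc | /eqP yc] := starP st1 xy.
  by rewrite xc Fc; have [|//] := FN y; rewrite inE -xc.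
by rewrite yc Fc adj_sym; have [|//] := FN x; rewrite inE -yc adj_sym.
Qed.

(** Stronger than [T] being a clique: all vertices outside [T] are isolated. *)
Definition clique_on (V : finType) (G : sgraph V) (T : {set V}) : Prop :=
  forall x y, adj G x y = [&& x != y, x \in T & y \in T].

Lemma card_edge_clique (V : finType) (G : sgraph V) (T : {set V}) :
  clique_on G T -> #|edge G| = 'C(#|T|, 2).
Proof.
move=> cl; rewrite card_sig -cards_draws; apply: eq_card => e.
rewrite [RHS]inE; apply/idP/andP=> [eE | [eT /cards2P]]; last first.
  move=> [x [y [xy eq_e]]].
  by move: eT; rewrite eq_e inE edge_setE cl xy subUset !sub1set.
have [x [y [xy eq_e]]] := edgeP (Sub e eE : edge G).
rewrite /= in eq_e; rewrite eq_e cards2 (adj_neq xy).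
by move: xy; rewrite cl subUset !sub1set => /andP[_ ->].
Qed.

Lemma clique_isomorphic (V : finType) (G1 G2 : sgraph V) (T1 T2 : {set V}) :
  #|edge G1| = #|edge G2| -> #|T1| = #|T2| ->
  clique_on G1 T1 -> clique_on G2 T2 -> isomorphic G1 G2.
Proof.
move=> eqE eqT cl1 cl2.
have [v0 _ | V0] := pickP (mem V); last first.
  by exists id => [|x]; [exists id | have := V0 x].
apply: (edge_hom_isomorphic (S := T1) (f := transfer v0 T1 T2) eqE).
- exact: transfer_inj.
- by move=> x y; rewrite cl1 => /and3P[].
move=> x y; rewrite cl1 cl2 => /and3P[xy Tx Ty].
rewrite !transfer_mem // !andbT; apply: contra_neq xy.
exact: transfer_inj.
Qed.

(** * Graphs whose edges pairwise meet *)

Lemma intersecting_star_or_triangle (V : finType) (G : sgraph V) (a b : V) :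
  adj G a b ->
  (forall e f : edge G, ~~ [disjoint val e & val f]) ->
  (exists c, star G c) \/ (exists2 T : {set V}, #|T| = 3%N & clique_on G T).
Proof.
move=> ab meet.
have hit x y z t : adj G x y -> adj G z t ->
    [|| z == x, z == y, t == x | t == y].
  move=> /adj_edge[e eq_e] /adj_edge[f eq_f].
  have /pred0Pn[u] := meet e f; rewrite /= eq_e eq_f !inE.
  by case/andP=> /orP[]/eqP-> /orP[]/eqP->; rewrite eqxx ?orbT.
have [sta | /forallPn[[x y]]] := boolP (star G a); first by left; exists a.
rewrite negb_imply negb_or /= => /and3P[xy xa ya].
(* The edge avoiding [a] must meet {a, b} in [b]. *)
have [c ca bc] : exists2 c, c != a & adj G b c.
  move: (hit _ _ _ _ ab xy); rewrite (negPf xa) (negPf ya) /=.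
  by case/orP=> /eqP eb; [exists y | exists x]; rewrite -?eb // adj_sym.
have [stb | /forallPn[[z t]]] := boolP (star G b); first by left; exists b.
rewrite negb_imply negb_or /= => /and3P[zt zb tb].
(* The edge avoiding [b] meets {a, b} in [a] and {b, c} in [c]. *)
have ac : adj G a c.
  move: (hit _ _ _ _ ab zt) (hit _ _ _ _ bc zt).
  rewrite (negPf zb) (negPf tb) /= orbF => /orP[]/eqP za /orP[]/eqP zc.
  - by move: ca; rewrite -za -zc eqxx.
  - by rewrite -za -zc.
  - by rewrite -za -zc adj_sym.
  - by move: ca; rewrite -za -zc eqxx.
have [[nab nbc] nac] := (adj_neq ab, adj_neq bc, adj_neq ac).
right; exists [set a; b; c].
  by rewrite setUC cardsU1 cards2 !inE nab /= negb_or ![c == _]eq_sym nac nbc.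
move=> u v; apply/idP/and3P=> [uv | [uv]].
  have := adj_neq uv.
  move: (hit _ _ _ _ ab uv) (hit _ _ _ _ bc uv) (hit _ _ _ _ ac uv).
  rewrite !inE => hab hbc hac nuv.
  (* Were one endpoint outside the triangle, the other would lie on all three of its sides. *)
  split=> //; apply: contraT;
    rewrite !negb_or => /andP[/andP[/negPf na /negPf nb] /negPf nc];
    move: hab hbc hac; rewrite na nb nc ?orbF /= => /orP[]/eqP->;
    by rewrite ?(negPf nac) ?(negPf nbc) ?[b == a]eq_sym (negPf nab).
rewrite !inE => /orP[/orP[]|]/eqP eu /orP[/orP[]|]/eqP ev; move: uv;
  rewrite eu ev ?eqxx // => _; by rewrite // adj_sym.
Qed.

(** * Eigenvalues of stars and triangles *)

Lemma star_eigenvalue (F : fieldType) (V : finType) (G : sgraph V) (c : V) :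
  star G c -> (#|edge G|%:R : F) != 0 ->
  root (char_poly (laplacian (fun _ : edge G => 1 : F))) (#|edge G|.+1%:R).
Proof.
move=> stc m0; rewrite -eigenvalue_root_char; apply/eigenvalueP.
(* With m edges, [v] is m at the centre, -1 at each leaf and 0 elsewhere: the centre receives m (m +
   1) and a leaf -1 - m. *)
pose v : 'rV[F]_#|V| := \row_j
  let a := enum_val j in if a == c then #|edge G|%:R else - (adj G c a)%:R.
have vE a : v 0 (enum_rank a) =
    if a == c then #|edge G|%:R else - (adj G c a)%:R.
  by rewrite mxE enum_rankK.
exists v; last first.
  apply: contraNneq m0 => /rowP/(_ (enum_rank c)).
  by rewrite vE eqxx mxE => ->.
apply/rowP=> j; rewrite -(enum_valK j); move: (enum_val j) => b.
rewrite mul_laplacian [RHS]mxE vE; case: eqP => [-> | /eqP bc].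
  rewrite (eq_bigr (fun=> #|edge G|.+1%:R)) => [|a ac].
    rewrite sumr_const (card_edge_star stc) mulr_natr; congr (_ *+ _).
    by apply: eq_card => a; rewrite !inE adj_sym.
  by rewrite vE (negPf (adj_neq ac)) adj_sym ac opprK natr1.
case: (boolP (adj G c b)) => cb.
  rewrite (big_pred1 c) => [|a].
    by rewrite vE eqxx mulrN1 -opprD nat1r.
  apply/idP/eqP=> [ab | ->//]; have := starP stc ab.
  by rewrite (negPf bc) orbF => /eqP.
rewrite oppr0 mulr0 big_pred0 // => a; apply: contraNF cb => ab.
by have := starP stc ab; rewrite (negPf bc) orbF => /eqP<-.
Qed.

(** An eigenvector for 4 vanishes off [T]; at each vertex of [T] its value x satisfies 3 x - s = 4
    x, where s is its sum over [T]. Thus x = - s, and summing gives s = - 3 s, so s = 0. *)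
Lemma clique3_eigenvalue (F : numFieldType) (V : finType) (G : sgraph V)
    (T : {set V}) :
  #|T| = 3%N -> clique_on G T ->
  ~~ root (char_poly (laplacian (fun _ : edge G => 1 : F))) 4%:R.
Proof.
move=> T3 cl; rewrite -eigenvalue_root_char.
apply/eigenvalueP=> -[v eig /negP[]].
have eigE b : (\sum_(a | adj G a b) (v 0 (enum_rank b) - v 0 (enum_rank a))) =
    4%:R * v 0 (enum_rank b) by rewrite -mul_laplacian eig mxE.
pose s := \sum_(a in T) v 0 (enum_rank a).
have out b : b \notin T -> v 0 (enum_rank b) = 0.
  move=> nTb; have /esym/eqP := eigE b.
  rewrite big_pred0 => [|a]; last by rewrite cl (negPf nTb) !andbF.
  by rewrite mulf_eq0 pnatr_eq0 => /eqP.
have inn b : b \in T -> v 0 (enum_rank b) = - s.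
  move=> Tb; have := eigE b.
  have -> : \sum_(a | adj G a b) (v 0 (enum_rank b) - v 0 (enum_rank a)) =
            v 0 (enum_rank b) *+ 3 - s.
    (* The term at [b] itself is zero, so the sum over the neighbours of [b] may run over all of
       [T]. *)
    rewrite -T3 -sumr_const -sumrB [RHS](bigD1 b) //= subrr add0r.
    by apply: eq_bigl => a; rewrite cl Tb andbT andbC.
  by rewrite mulr_natl [_ *+ 4]mulrSr => /addrI ->.
have s0 : s = 0.
  have : s = - s *+ 3 by rewrite {1}/s (eq_bigr _ inn) sumr_const T3.
  move=> /eqP; rewrite -subr_eq0 mulNrn opprK -mulrS mulrn_eq0 /=.
  by move/eqP.
apply/eqP/rowP=> j; rewrite -(enum_valK j) mxE.
have [/inn -> | /out //] := boolP (enum_val j \in T).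
by rewrite s0 oppr0.
Qed.

(** * Isospectral graphs and the final case analysis *)

Lemma isospectral_card_edge (V : finType) (G1 G2 : sgraph V) :
  isospectral G1 G2 -> #|edge G1| = #|edge G2|.
Proof.
move=> /isospectral_char_poly/mxtrace_char_poly; rewrite !mxtrace_laplacian.
by rewrite !sumr_const -!mulrnA => /eqP; rewrite eqr_nat !eqn_pmul2l // => /eqP.
Qed.

(** Equal edge counts force the star to have three edges, so 3 + 1 = 4 is one of its eigenvalues. *)
Lemma star_triangle_not_isospectral (V : finType) (G1 G2 : sgraph V)
    (c : V) (T : {set V}) :
  star G1 c -> #|T| = 3%N -> clique_on G2 T -> ~ isospectral G1 G2.
Proof.
move=> stc T3 cl iso.
have m3 : #|edge G1| = 3%N.
  by rewrite (isospectral_card_edge iso) (card_edge_clique cl) T3.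
have := clique3_eigenvalue algC T3 cl.
rewrite -(isospectral_char_poly iso).
have := star_eigenvalue (F := algC) stc; rewrite m3 pnatr_eq0 => /(_ isT) r r'.
by rewrite r in r'.
Qed.

Lemma intersecting_isomorphic (V : finType) (G1 G2 : sgraph V) (e1 : edge G1)
    (e2 : edge G2) :
  isospectral G1 G2 ->
  (forall e f : edge G1, ~~ [disjoint val e & val f]) ->
  (forall e f : edge G2, ~~ [disjoint val e & val f]) ->
  isomorphic G1 G2.
Proof.
move=> iso meet1 meet2; have eqE := isospectral_card_edge iso.
have [x1 [y1 [xy1 _]]] := edgeP e1; have [x2 [y2 [xy2 _]]] := edgeP e2.
have [[c1 st1] | [T1 T13 cl1]] := intersecting_star_or_triangle xy1 meet1;
have [[c2 st2] | [T2 T23 cl2]] := intersecting_star_or_triangle xy2 meet2.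
- exact: star_isomorphic st1 st2.
- by case: (star_triangle_not_isospectral st1 T23 cl2 iso).
- by case: (star_triangle_not_isospectral st2 T13 cl1 (fun a => esym (iso a))).
- by apply: (clique_isomorphic eqE _ cl1 cl2); rewrite T13.
Qed.

Theorem theorem4p3 (V : finType) (G1 G2 : sgraph V)
    (hniso : ~ isomorphic G1 G2) (hspec : isospectral G1 G2) :
  exists (D1 : diffusion G1) (D2 : diffusion G2),
    equivalent D1 D2 /\ spectral_poly D1 <> spectral_poly D2.
Proof.
have eqE := isospectral_card_edge hspec.
(* With at most one edge, both graphs are matchings vacuously. *)
have [le1 | ] := leqP #|edge G1| 1.
  case: hniso; apply: matching_isomorphic => // e f.
    by rewrite (fintype_le1P le1 e f) eqxx.
  by rewrite eqE in le1; rewrite (fintype_le1P le1 e f) eqxx.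
move=> gt1; have := gt1; rewrite eqE => /card_gt1P[s2 [t2 [_ _ st2]]].
have /card_gt1P[s1 [t1 [_ _ st1]]] := gt1.
have [/existsP[[[s t] [s' t']] /and3P[/= st st' neq]] | /existsPn same] := boolP
  [exists p : (edge G1 * edge G1) * (edge G2 * edge G2),
    [&& p.1.1 != p.1.2, p.2.1 != p.2.2 &
        #|val p.1.1 :&: val p.1.2| != #|val p.2.1 :&: val p.2.2|]].
  exact: separating_diffusion eqE st st' neq.
have {}same (s t : edge G1) (s' t' : edge G2) : s != t -> s' != t' ->
    #|val s :&: val t| = #|val s' :&: val t'|.
  move=> st st'; have := same ((s, t), (s', t')); rewrite /= st st' /=.
  by rewrite negbK => /eqP.
case: hniso.
(* Comparing through a fixed pair of the other graph gives one intersection size common to all pairs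
   of distinct edges in both graphs. *)
have same1 (e f : edge G1) :
    e != f -> #|val e :&: val f| = #|val s1 :&: val t1|.
  by move=> ef; rewrite (same _ _ _ _ ef st2) (same _ _ _ _ st1 st2).
have same2 (e f : edge G2) :
    e != f -> #|val e :&: val f| = #|val s1 :&: val t1|.
  by move=> ef; rewrite (same _ _ _ _ st1 ef).
have [dis | meet] := boolP [disjoint val s1 & val t1].
  move: dis; rewrite -setI_eq0 -cards_eq0 => /eqP dis.
  by apply: matching_isomorphic => // e f ef;
    rewrite -setI_eq0 -cards_eq0 ?(same1 _ _ ef) ?(same2 _ _ ef) dis.
have meetE (G : sgraph V) (e f : edge G) :
    (e != f -> #|val e :&: val f| = #|val s1 :&: val t1|) ->
    ~~ [disjoint val e & val f].
  (* For e = f the claim is that an edge is nonempty. *)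
  have [-> _ | ef /(_ isT) eq_ef] := eqVneq e f.
    by rewrite -setI_eq0 setIid -cards_eq0 card_edge.
  by rewrite -setI_eq0 -cards_eq0 eq_ef cards_eq0 setI_eq0.
apply: (intersecting_isomorphic s1 s2 hspec) => e f; apply: meetE.
- exact: same1.
- exact: same2.
Qed.
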